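(* Let $n$ and $k$ be positive integers with $n \geq 33k^2$. For any real numbers $x_1,\dots,x_n$ with $\sum_{i=1}^n x_i \geq 0$, the number of $k$-element subsets $S\subseteq\{1,\dots,n\}$ with $\sum_{i\in S} x_i \geq 0$ is at least $\binom{n-1}{k-1}$. *)

(* Defs.v *)
From mathcomp Require Export all_boot all_order all_algebra.
From mathcomp Require Export reals.

Set Implicit Arguments.
Unset Strict Implicit.
Unset Printing Implicit Defensive.

(* Main.v *)
Require Import Defs.
From mathcomp Require Import all_boot all_order all_algebra all_fingroup.
From mathcomp Require Import reals ring lra zify.

(* Write C = 'C(n-1, k-1), let L consist of the l = n / 2k smallest x_i, let U be its
   complement and D >= 0 the sum of x over U; every x_i in U is at least -D / l. By the
   one-sided Chebyshev inequality, for a random (k-1)-subset A of U \ i with x_i > 0,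
     P(x_i + sum_A x >= 0) >= g_i^2 / (g_i^2 + v),
   where th = (k-1) / (|U|-1), g_i = (1 - th) x_i + th D and v = th * sum_U x^2. There are
   at least C / 2 such subsets A, so this bounds from below the degree of i, the number of
   nonnegative k-sets through i.

   If g_i^2 >= v for some i, then i has degree at least C / 4. Either all k-sets through i
   are nonnegative, or some k-set B through i is negative; then the complement of B has
   positive sum, and keeping its k * q largest elements, q = (n-k) / k, and averaging over
   the partitions into blocks of size k gives 'C(kq-1, k-1) >= 3 C / 4 further nonnegative
   sets, which avoid i.

   Otherwise every positive i in U has degree at least C g_i^2 / 4v. The cross terms
   2 th (1 - th) D x_i in the sum of the g_i^2 compensate for the negative x_i in
   sum_U x^2 (which contribute at most D / l times the sum of the positive ones), so
   that the degrees add up to at least k C. *)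

Import Order.TTheory GRing.Theory Num.Theory.
Local Open Scope ring_scope.

(** * Estimates for binomial coefficients *)

(** Union bound: a random [m]-subset of an [N]-set meets a fixed set of [a] points with probability
    at most [a * m / N]. *)
Lemma bin_sub_ge (N a m : nat) :
  (N * 'C(N, m) <= N * 'C(N - a, m) + a * m * 'C(N, m))%N.
Proof.
case: m => [|m]; first by rewrite !bin0; lia.
elim: a => [|a IH]; first by rewrite subn0; lia.
apply: leq_trans IH _.
case e: (N - a)%N => [|M]; first by rewrite bin0n /=; lia.
have -> : (N - a.+1 = M)%N by lia.
have le_MN : (M <= N.-1)%N by lia.
have h := leq_bin2l m le_MN.
have h2 := mul_bin_diag N m.
rewrite binS; nia.
Qed.

Lemma bin_sub_half (n l m : nat) : (0 < n)%N -> (2 * (l * m) <= n)%N ->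
  ('C(n, m) <= 2 * 'C(n - l, m))%N.
Proof.
move=> n0 h; have hb := bin_sub_ge n l m.
rewrite -(leq_pmul2l n0); nia.
Qed.

(** Outside degenerate cases the difference is ['C(N-2, m-1)], at most ['C(N-1, m-1)], which is
    [m / N] times ['C(N, m)]. It is the diagonal coefficient of the second moment below. *)
Lemma bin_variance (N m : nat) :
  (N * ('C(N.-1, m) - 'C(N.-2, m)) <= m * 'C(N, m))%N.
Proof.
case: N => [//|[|N]] /=; first by rewrite subnn.
case: m => [|m]; first by rewrite !bin0 subnn muln0.
rewrite binS addKn -mul_bin_diag leq_mul2l /=.
by rewrite leq_bin2l.
Qed.

(** * Random subsets of fixed size *)

Section Sampling.
Set Implicit Arguments.
Unset Strict Implicit.
Variables (R : realFieldType) (T : finType).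
Implicit Types (U A B L : {set T}) (x y z : T -> R).

(** Splitting the count into a constant and a diagonal term lets the constant vanish when summed
    against [z i * z j] with [z] of sum zero. *)
Lemma card_avoid (U : {set T}) (m : nat) (i j : T) : i \in U -> j \in U ->
  #|[set A : {set T} | [&& A \subset U, #|A| == m, i \notin A & j \notin A]]|
  = ('C(#|U|.-2, m) + (i == j) * ('C(#|U|.-1, m) - 'C(#|U|.-2, m)))%N.
Proof.
move=> iU jU.
have -> : [set A : {set T} | [&& A \subset U, #|A| == m, i \notin A & j \notin A]]
   = [set A : {set T} | A \subset (U :\ i) :\ j & #|A| == m].
  apply/setP=> A; rewrite !inE !subsetD1.
  by case: (A \subset U); case: (#|A| == m); case: (i \in A); case: (j \in A).
rewrite cards_draws.
have e1 : #|U :\ i| = #|U|.-1 by rewrite (cardsD1 i U) iU.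
case: eqVneq => [<-|nij].
  rewrite mul1n subnKC ?leq_bin2l //; last by lia.
  by rewrite (setDidPl _) ?e1 // disjoint_sym disjoints1 !inE eqxx.
have e2 : #|U :\ i| = (#|(U :\ i) :\ j|).+1.
  by rewrite (cardsD1 j (U :\ i)) !inE jU eq_sym nij.
by rewrite addn0; congr 'C(_, _); lia.
Qed.

Lemma sum_subset_compl U z A : \sum_(i in U) z i = 0 -> A \subset U ->
  \sum_(i in A) z i = - \sum_(i in U) z i * (i \notin A)%:R.
Proof.
move=> z0 AU; apply/eqP; rewrite -addr_eq0; apply/eqP.
rewrite -[RHS]z0 [RHS](big_setID A) [X in _ + X = _](big_setID A) /= (setIidPr AU).
congr (_ + _); rewrite big1 ?add0r => [|i ->]; last by rewrite mulr0.
by apply: eq_bigr => i; rewrite inE => /andP[-> _]; rewrite mulr1.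
Qed.

(** Every point of [U] is avoided by the same number of [m]-subsets. *)
Lemma first_moment U (m : nat) z : \sum_(i in U) z i = 0 ->
  \sum_(A in [set A : {set T} | A \subset U & #|A| == m]) \sum_(i in A) z i = 0.
Proof.
move=> z0.
under eq_bigr => A /[!inE] /andP[AU _] do rewrite (sum_subset_compl z0 AU).
rewrite sumrN exchange_big /= -[RHS]oppr0; congr (- _).
transitivity (\sum_(i in U) 'C(#|U|.-1, m)%:R * z i); last by rewrite -mulr_sumr z0 mulr0.
apply: eq_bigr => i iU.
rewrite -mulr_sumr -natr_sum mulrC; congr (_%:R * _).
have := card_avoid m iU iU; rewrite eqxx mul1n subnKC ?leq_bin2l //; last by lia.
move=> <-; rewrite -sum1_card big_mkcond [RHS]big_mkcond; apply: eq_bigr => A _.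
by rewrite !inE andbb andbA; case: (_ && _) => //=; case: (i \in A).
Qed.

(* Since z sums to zero over U, a subset may be replaced by its complement, and pairs of
   points avoided by A are counted without case distinctions on m. *)
Lemma second_moment U (m : nat) z : \sum_(i in U) z i = 0 ->
  #|U|%:R * (\sum_(A in [set A : {set T} | A \subset U & #|A| == m])
     (\sum_(i in A) z i) ^+ 2)
  <= (m * 'C(#|U|, m))%:R * \sum_(i in U) z i ^+ 2.
Proof.
move=> z0.
set c0 := 'C(#|U|.-2, m); set c1 := ('C(#|U|.-1, m) - c0)%N.
have -> : \sum_(A in [set A : {set T} | A \subset U & #|A| == m])
     (\sum_(i in A) z i) ^+ 2 =
   \sum_(i in U) \sum_(j in U) z i * z j * (c0 + (i == j) * c1)%:R.
  transitivity (\sum_(A in [set A : {set T} | A \subset U & #|A| == m])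
     \sum_(i in U) \sum_(j in U) z i * z j * ((i \notin A) && (j \notin A))%:R).
    apply: eq_bigr => A; rewrite inE => /andP[AU _].
    rewrite (sum_subset_compl z0 AU).
    rewrite sqrrN expr2 mulr_suml; apply: eq_bigr => i _.
    rewrite mulr_sumr; apply: eq_bigr => j _.
    by rewrite -mulnb natrM; ring.
  rewrite exchange_big /=; apply: eq_bigr => i iU.
  rewrite exchange_big /=; apply: eq_bigr => j jU.
  rewrite -mulr_sumr -natr_sum -(card_avoid m iU jU) -sum1_card.
  congr (_ * _%:R); rewrite [RHS]big_mkcond [LHS]big_mkcond; apply: eq_bigr => A _.
  by rewrite !inE; case: (A \subset U); case: (#|A| == m) => //=; case: (i \in A); case: (j \in A).
have -> : \sum_(i in U) \sum_(j in U) z i * z j * (c0 + (i == j) * c1)%:R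
   = c1%:R * \sum_(i in U) z i ^+ 2.
  rewrite mulr_sumr; apply: eq_bigr => i iU.
  under eq_bigr => j _ do rewrite natrD mulrDr.
  rewrite big_split /= -mulr_suml -mulr_sumr z0 mulr0 mul0r add0r.
  rewrite (bigD1 i) //= eqxx mul1n big1 ?addr0; first by rewrite expr2 mulrC.
  by move=> j /andP[_ nji]; rewrite eq_sym (negPf nji) mulr0.
rewrite mulrA -natrM ler_wpM2r ?sumr_ge0 // => [i _|]; first exact: sqr_ge0.
by rewrite ler_nat bin_variance.
Qed.

(** After centring [y] at its mean over [U], the sum over a random [m]-subset has mean 0 and
    variance at most [v]; the event fails exactly when this centred sum is below [- g]. *)
Lemma cantelli U (m : nat) y (c : R) :
  let N := #|U| in
  let g := c + m%:R / N%:R * \sum_(i in U) y i in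
  let v := m%:R / N%:R * \sum_(i in U) y i ^+ 2 in
  (0 < N)%N -> 0 < g ->
  'C(N, m)%:R * g ^+ 2 <= (g ^+ 2 + v) *
   #|[set A : {set T} | [&& A \subset U, #|A| == m & 0 <= c + \sum_(i in A) y i]]|%:R.
Proof.
move=> N g v N0 g0.
have N0' : 0 < N%:R :> R by rewrite ltr0n.
set mu := (\sum_(i in U) y i) / N%:R.
pose z i := y i - mu.
have z0 : \sum_(i in U) z i = 0.
  rewrite sumrB sumr_const -mulr_natr /mu divfK ?subrr //; by rewrite gt_eqF.
have zz : \sum_(i in U) z i ^+ 2 <= \sum_(i in U) y i ^+ 2.
  have -> : \sum_(i in U) y i ^+ 2 = \sum_(i in U) z i ^+ 2 + N%:R * mu ^+ 2.
    have e i : y i ^+ 2 = z i ^+ 2 + (2 * mu * z i + mu ^+ 2) by rewrite /z; ring.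
    rewrite (eq_bigr _ (fun i _ => e i)) !big_split /= -mulr_sumr z0 sumr_const.
    by rewrite -[mu ^+ 2 *+ _]mulr_natl mulr0 add0r.
  by rewrite lerDl mulr_ge0 ?sqr_ge0 ?ltW.
have v0 : 0 <= v.
  by rewrite mulr_ge0 ?divr_ge0 ?ler0n // sumr_ge0 // => i _; apply: sqr_ge0.
set E := [set A : {set T} | A \subset U & #|A| == m].
set G := [set A | _].
have sGE : G \subset E by apply/subsetP => A; rewrite !inE => /and3P[-> ->].
have cE : #|E| = 'C(N, m) by rewrite cards_draws.
have sm : \sum_(A in E) (\sum_(i in A) z i) ^+ 2 <= 'C(N, m)%:R * v.
  have := second_moment m z0; rewrite -/E -/N => h.
  rewrite -(ler_pM2l N0') (le_trans h) // natrM /v.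
  rewrite (_ : N%:R * _ = m%:R * 'C(N, m)%:R * \sum_(i in U) y i ^+ 2); last first.
    by field; rewrite gt_eqF.
  by rewrite ler_wpM2l // mulr_ge0 ?ler0n.
have s1 : \sum_(A in E) \sum_(i in A) z i = 0 by exact: first_moment.
(* Markov's inequality for (Z - v / g)^2 *)
set t := v / g.
have bad : (#|E :\: G|)%:R * (g + t) ^+ 2 <= 'C(N, m)%:R * (v + t ^+ 2).
  have -> : 'C(N, m)%:R * (v + t ^+ 2) = 'C(N, m)%:R * v
      - 2 * t * (\sum_(A in E) \sum_(i in A) z i) + \sum_(A in E) t ^+ 2.
    by rewrite s1 sumr_const cE -[t ^+ 2 *+ _]mulr_natr; ring.
  apply: (@le_trans _ _ (\sum_(A in E) (\sum_(i in A) z i - t) ^+ 2)); last first.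
    under eq_bigr => A _ do rewrite sqrrB.
    rewrite big_split sumrB /= lerD2r lerB // mulr_sumr.
    by rewrite le_eqVlt; apply/orP; left; apply/eqP/eq_bigr => A _; ring.
  rewrite [leRHS](big_setID G) /= (setIidPr sGE) mulr_natl -sumr_const.
  rewrite -[leLHS]add0r lerD ?sumr_ge0 // => [A _|]; first exact: sqr_ge0.
  apply: ler_sum => A; rewrite !inE => /andP[+ /andP[AU cA]].
  rewrite AU cA /= -ltNge => h.
  have hz : \sum_(i in A) z i < - g.
    rewrite /z sumrB sumr_const (eqP cA) -mulr_natr /mu /g; lra.
  have t0 : 0 <= t by rewrite divr_ge0 // ltW.
  have -> : (\sum_(i in A) z i - t) ^+ 2 = (t - \sum_(i in A) z i) ^+ 2 by ring.
  by rewrite ler_sqr ?nnegrE; lra.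
have eD : 'C(N, m)%:R = #|G|%:R + #|E :\: G|%:R :> R.
  by rewrite -cE -(cardsID G E) (setIidPr sGE) natrD.
(* The choice [t = v / g] puts the factor [(g ^+ 2 + v) / g ^+ 2] on both sides of [bad], where it
   cancels. *)
have h1 : (#|E :\: G|)%:R * (g ^+ 2 + v) <= 'C(N, m)%:R * v.
  have gv0 : 0 < g ^+ 2 + v by rewrite ltr_wpDr // exprn_gt0.
  have e1 : (g + t) ^+ 2 = (g ^+ 2 + v) * ((g ^+ 2 + v) / g ^+ 2).
    by rewrite /t; field; rewrite gt_eqF.
  have e2 : v + t ^+ 2 = v * ((g ^+ 2 + v) / g ^+ 2).
    by rewrite /t; field; rewrite gt_eqF.
  by move: bad; rewrite e1 e2 mulrA [leRHS]mulrA ler_pM2r // divr_gt0 ?exprn_gt0.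
rewrite eD in h1 *; lra.
Qed.

(** * Removing the smallest elements *)

Lemma smallest_subset x U (l : nat) : (l <= #|U|)%N ->
  exists L : {set T}, [/\ L \subset U, #|L| = l &
    forall i j, i \in L -> j \in U :\: L -> x i <= x j].
Proof.
elim: l => [_|l IH lU].
  by exists set0; split; [exact: sub0set|exact: cards0|move=> i j; rewrite inE].
have [L [LU cL hL]] := IH (ltnW lU).
have [j0 j0D] : exists j, j \in U :\: L.
  by apply/set0Pn; rewrite -card_gt0 cardsD (setIidPr LU); lia.
have [j jD jmin] := arg_minP x j0D.
have /setDP[jU jL] : j \in U :\: L by [].
exists (j |: L); split.
- by rewrite subUset sub1set jU.
- by rewrite cardsU1 jL cL.
move=> a b /setU1P[-> | aL] /setDP[bU /[!inE]/norP[nbj bL]].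
- by apply: jmin; apply/setDP.
- by apply: hL => //; apply/setDP.
Qed.

Lemma sum_ge_smallest x U L : L \subset U ->
  (forall i j, i \in L -> j \in U :\: L -> x i <= x j) ->
  forall j, j \in U :\: L -> \sum_(i in L) x i <= #|L|%:R * x j.
Proof.
move=> LU hL j jD; rewrite mulr_natl -sumr_const.
by apply: ler_sum => i iL; apply: hL.
Qed.

(** If some remaining value is negative, all values on [L] are negative too, so removing [L] can
    only raise the sum. *)
Lemma sum_rest_ge0 x U L : L \subset U ->
  (forall i j, i \in L -> j \in U :\: L -> x i <= x j) ->
  0 <= \sum_(i in U) x i -> 0 <= \sum_(i in U :\: L) x i.
Proof.
move=> LU hL; rewrite (big_setID L) /= (setIidPr LU) => h.
have [/existsP[j /andP[jD xj]]|] := boolP [exists j, (j \in U :\: L) && (x j < 0)].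
  have hj := sum_ge_smallest LU hL jD.
  have : \sum_(i in L) x i <= 0.
    by apply: le_trans hj _; rewrite mulr_ge0_le0 // ltW.
  lra.
rewrite negb_exists => /forallP h'; apply: sumr_ge0 => j jD.
by have := h' j; rewrite jD /= leNgt.
Qed.

(** * Averaging over partitions into blocks *)

(** Random partitions of [U] are modelled by permutations: a fixed block [A] is carried to the
    random set [s @: A]. *)
Definition nonneg_perms x U A :=
  [set s : {perm T} | perm_on U s & 0 <= \sum_(i in A) x (s i)].

Lemma nonneg_perms_tperm x U A a b : a \in U -> b \in U ->
  #|nonneg_perms x U (tperm a b @: A)| = #|nonneg_perms x U A|.
Proof.
move=> aU bU.
rewrite -(card_imset _ (mulgI (tperm a b))); apply: eq_card => s.
have tU : perm_on U (tperm a b).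
  apply/subsetP => i; rewrite inE; case: tpermP => [->|->|] //; by rewrite ?eqxx.
apply/imsetP/idP => [[u]|].
  rewrite !inE => /andP[uU h] ->; rewrite perm_onM //=.
  move: h; rewrite big_imset /=; last by move=> i j _ _; apply: perm_inj.
  by under eq_bigr => i _ do rewrite -permM.
rewrite !inE => /andP[sU h]; exists ((tperm a b)^-1 * s)%g; last by rewrite mulKVg.
rewrite inE tpermV perm_onM //=.
rewrite big_imset /=; last by move=> i j _ _; apply: perm_inj.
by under eq_bigr => i _ do rewrite permM tpermK.
Qed.

(** Induction on the size of [A :\: B]: a transposition exchanges a point of [A :\: B] for one of
    [B :\: A] without changing the count. *)
Lemma card_nonneg_perms_eq x U A B : A \subset U -> B \subset U -> #|A| = #|B| ->
  #|nonneg_perms x U A| = #|nonneg_perms x U B|.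
Proof.
elim: {A}_.+1 {-2}A (ltnSn #|A :\: B|) => // d IH A hd AU BU eAB.
have [AB|] := boolP (A \subset B).
  by have /eqP-> : A == B by rewrite eqEcard AB eAB leqnn.
move=> /subsetPn[a aA aB].
have [b bB bA] : exists2 b, b \in B & b \notin A.
  apply/subsetPn/negP => BA; have /eqP e : B == A by rewrite eqEcard BA eAB leqnn.
  by rewrite e aA in aB.
have aU := subsetP AU a aA; have bU := subsetP BU b bB.
rewrite -(nonneg_perms_tperm x A aU bU).
have eI : tperm a b @: A = b |: (A :\ a).
  apply/setP => i; rewrite -[i](tpermK a b) mem_imset; last exact: perm_inj.
  rewrite tpermK !inE; case: (tpermP a b i) => [->|->|].
  - by rewrite eqxx (negPf bA) /= orbF; apply/esym/eqP => ab; rewrite -ab aA in bA.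
  - by rewrite eqxx aA.
  - by move=> /eqP/negPf-> /eqP/negPf->.
apply: IH => //.
- rewrite ltnS in hd; apply: leq_trans hd; rewrite eI; apply: proper_card.
  apply/properP; split.
    apply/subsetP => i; rewrite !inE => /andP[iB /orP[/eqP ib|/andP[_ ->]]].
      by rewrite ib bB in iB.
    by rewrite iB.
  exists a; first by rewrite inE aA aB.
  by rewrite !inE eqxx /= orbF negb_and aB /=; apply/eqP => ab; rewrite ab bB in aB.
- by rewrite eI subUset sub1set bU (subset_trans (subD1set _ _) AU).
- by rewrite card_imset //; apply: perm_inj.
Qed.

(* A nonnegative sum over A forces a nonnegative sum over a block of A or over the rest. *)
Lemma nonneg_perms_blocks x U B (q : nat) A : B \subset U -> A \subset U ->
  #|A| = (#|B| * q.+1)%N ->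
  (#|nonneg_perms x U A| <= q.+1 * #|nonneg_perms x U B|)%N.
Proof.
move=> BU; elim: q A => [|q IH] A AU cA.
  by rewrite mul1n (card_nonneg_perms_eq x AU BU) // cA muln1.
have [C [CA cC _]] : exists L : {set T}, [/\ L \subset A, #|L| = #|B| &
    forall i j, i \in L -> j \in A :\: L -> x i <= x j].
  by apply: smallest_subset; rewrite cA; nia.
have h1 : #|nonneg_perms x U C| = #|nonneg_perms x U B|.
  by apply: card_nonneg_perms_eq => //; apply: subset_trans AU.
have h2 : (#|nonneg_perms x U (A :\: C)| <= q.+1 * #|nonneg_perms x U B|)%N.
  apply: IH; first by apply: subset_trans AU; apply: subsetDl.
  by rewrite cardsD (setIidPr CA) cA cC; nia.
apply: (@leq_trans #|nonneg_perms x U C :|: nonneg_perms x U (A :\: C)|); last first.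
  by apply: leq_trans (leq_card_setU _ _) _; rewrite h1 mulSn leq_add2l.
apply/subset_leq_card/subsetP => s; rewrite !inE => /andP[-> /=].
rewrite (big_setID C) /= (setIidPr CA) => h.
by case: leP => //= h'; lra.
Qed.

(** Double counting of pairs [(B, s)]: for fixed [s], the map [B |-> s @: B] permutes the
    [k]-subsets of [U]. *)
Lemma sum_nonneg_perms x U (k : nat) :
  (\sum_(B in [set B : {set T} | B \subset U & #|B| == k]) #|nonneg_perms x U B|
  = #|[set s : {perm T} | perm_on U s]| *
    #|[set B : {set T} | [&& B \subset U, #|B| == k & (0 <= \sum_(i in B) x i)%R]]|)%N.
Proof.
rewrite -sum_nat_const.
under eq_bigr => B _ do rewrite -sum1_card big_mkcond /=.
rewrite exchange_big /= (bigID [pred s | perm_on U s]) /= addnC big1 ?add0n.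
  apply: eq_big => [s|s sU]; first by rewrite inE.
  rewrite -sum1_card -big_mkcondr /=.
  have sK (A : {set T}) : s @: (s^-1%g @: A) = A.
    by rewrite -imset_comp (eq_imset (g := id)) ?imset_id // => i /=; rewrite permKV.
  have Ks (A : {set T}) : s^-1%g @: (s @: A) = A.
    by rewrite -imset_comp (eq_imset (g := id)) ?imset_id // => i /=; rewrite permK.
  have s_sub A : (s @: A \subset U) = (A \subset U).
    apply/idP/idP => h; last by rewrite -(im_perm_on sU) imsetS.
    by rewrite -(Ks A) -(Ks U) imsetS // (im_perm_on sU).
  rewrite [RHS](reindex_onto (fun A => s @: A) (fun A => s^-1%g @: A)) => [|A _]; last exact: sK.
  rewrite big_mkcond [RHS]big_mkcond /=; apply: eq_bigr => A _.
  rewrite !inE Ks eqxx andbT s_sub sU card_imset; last exact: perm_inj.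
  rewrite big_imset /=; last by move=> i j _ _; apply: perm_inj.
  by rewrite andbA.
move=> s sU; apply: big1 => B _; by rewrite inE (negPf sU).
Qed.

(** Each permutation of [U] makes at least one of [q] blocks nonnegative, so a random [k]-subset is
    nonnegative with probability at least [1 / q]; and ['C(k * q, k) = q * 'C((k * q).-1, k.-1)]. *)
Lemma nonneg_subsets_mult x U (k q : nat) : (0 < k)%N -> (0 < q)%N ->
  #|U| = (k * q)%N -> 0 <= \sum_(i in U) x i ->
  ('C((k * q).-1, k.-1) <=
   #|[set B : {set T} | [&& B \subset U, #|B| == k & (0 <= \sum_(i in B) x i)%R]]|)%N.
Proof.
move=> k0; case: q => // q _ cU Ux.
have h := sum_nonneg_perms x U k.
set H := #|[set B : {set T} | _]| in h *.
set M := #|[set s | _]| in h.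
have M0 : (0 < M)%N by apply/card_gt0P; exists 1%g; rewrite inE perm_on1.
have [B [BU cB _]] : exists L : {set T}, [/\ L \subset U, #|L| = k &
    forall i j, i \in L -> j \in U :\: L -> x i <= x j].
  by apply: smallest_subset; rewrite cU; nia.
have h1 : ('C(#|U|, k) * #|nonneg_perms x U B| = M * H)%N.
  rewrite -h -cards_draws -sum_nat_const; apply: eq_bigr => A; rewrite inE => /andP[AU /eqP cA].
  by apply: card_nonneg_perms_eq => //; rewrite cA.
have h2 : (M <= q.+1 * #|nonneg_perms x U B|)%N.
  apply: leq_trans (nonneg_perms_blocks x (q := q) BU (subxx U) _); last by rewrite cB.
  apply/subset_leq_card/subsetP => s; rewrite !inE => sU; rewrite sU /=.
  have <- : \sum_(i in s @: U) x i = \sum_(i in U) x (s i).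
    by rewrite big_imset //= => i j _ _; apply: perm_inj.
  by rewrite (im_perm_on sU).
have h3 := mul_bin_diag #|U| k.-1; rewrite prednK // cU in h3 h1.
rewrite -(leq_pmul2l (m := (M * (k * q.+1))%N)); last by rewrite !muln_gt0 M0 k0.
nia.
Qed.

End Sampling.

(** * Degrees in the hypergraph of nonnegative k-sets *)

Section NonnegativeSums.
Set Implicit Arguments.
Unset Strict Implicit.
Variables (R : realFieldType) (T : finType) (k : nat) (x : T -> R).
Implicit Types (U A B L : {set T}).

Definition nonneg_sets :=
  [set S : {set T} | (#|S| == k) && (0 <= \sum_(i in S) x i)].

Definition degree i := #|[set S in nonneg_sets | i \in S]|.

Lemma sum_degree : (\sum_i degree i = k * #|nonneg_sets|)%N.
Proof.
rewrite mulnC -sum_nat_const.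
under eq_bigr => i _ do rewrite /degree -sum1_card big_mkcond /=.
rewrite exchange_big /= [RHS]big_mkcond /=; apply: eq_bigr => S _.
under eq_bigr => i _ do rewrite inE.
case: ifP => [|_] /=; last by rewrite big1.
by rewrite inE => /andP[/eqP<- _]; rewrite -big_mkcond sum1_card.
Qed.

Lemma degree_ge U i : (0 < k)%N -> i \in U ->
  (#|[set A : {set T} | [&& A \subset U :\ i, #|A| == k.-1 &
      (0 <= x i + \sum_(j in A) x j)%R]]| <= degree i)%N.
Proof.
move=> k0 iU; set E := [set A | _].
have EiP A : A \in E -> i \notin A.
  by rewrite inE subsetD1 => /andP[/andP[_ ->]].
rewrite -(card_in_imset (f := fun A => i |: A)) => [|A B /EiP iA /EiP iB e]; last first.
  by rewrite -(setU1K iA) e setU1K.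
apply/subset_leq_card/subsetP => S /imsetP[A AE ->].
have iA := EiP _ AE; move: AE; rewrite !inE => /and3P[_ /eqP cA h].
by rewrite eqxx cardsU1 iA cA add1n prednK // eqxx andbT big_setU1.
Qed.

Lemma star_le i : (0 < k)%N ->
  (forall S : {set T}, #|S| = k -> i \in S -> 0 <= \sum_(j in S) x j) ->
  ('C(#|T|.-1, k.-1) <= #|nonneg_sets|)%N.
Proof.
move=> k0 h; apply: (@leq_trans (degree i)); last first.
  by apply/subset_leq_card/subsetP => S; rewrite inE => /andP[].
apply: leq_trans (degree_ge k0 (in_setT i)).
have e : #|T|.-1 = #|[set: T] :\ i| by rewrite -cardsT (cardsD1 i) in_setT.
rewrite e -cards_draws; apply/subset_leq_card/subsetP => A.
rewrite !inE => /andP[Ai /eqP cA]; rewrite Ai cA eqxx /=.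
have iA : i \notin A by move: Ai; rewrite subsetD1 => /andP[].
by rewrite -big_setU1 //= h ?setU11 // cardsU1 iA cA add1n prednK.
Qed.

Lemma avoiding_ge i B : (0 < k)%N -> (2 * k <= #|T|)%N -> 0 <= \sum_j x j ->
  #|B| = k -> i \in B -> \sum_(j in B) x j < 0 ->
  ('C(#|T| - 2 * k, k.-1) <= #|[set S in nonneg_sets | i \notin S]|)%N.
Proof.
move=> k0 kT x0 cB iB Bneg.
have cV : #|~: B| = (#|T| - k)%N by rewrite cardsCs setCK cB.
have V0 : 0 <= \sum_(j in ~: B) x j.
  move: x0; rewrite (bigID [in B]) /=.
  under [X in _ + X]eq_bigl => j do rewrite -in_setC.
  lra.
have ediv := divn_eq (#|T| - k) k; have rlt := ltn_pmod (#|T| - k) k0.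
set q := ((#|T| - k) %/ k)%N in ediv; set r := ((#|T| - k) %% k)%N in ediv rlt.
have [L [LV cL hL]] : exists L : {set T}, [/\ L \subset ~: B, #|L| = r &
    forall i j, i \in L -> j \in ~: B :\: L -> x i <= x j].
  by apply: smallest_subset; lia.
have q0 : (0 < q)%N by rewrite divn_gt0 //; lia.
have cW : #|~: B :\: L| = (k * q)%N by rewrite cardsD (setIidPr LV) cL; lia.
have := nonneg_subsets_mult k0 q0 cW (sum_rest_ge0 LV hL V0).
(* As the remainder [r] is less than [k], [k * q = #|T| - k - r] exceeds [#|T| - 2 * k]. *)
move=> h; apply: (@leq_trans 'C((k * q).-1, k.-1)); first by apply: leq_bin2l; lia.
apply: leq_trans h _; apply/subset_leq_card/subsetP => S.
rewrite !inE => /and3P[/subsetP SW -> ->] /=.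
by apply/negP => /SW; rewrite !inE iB andbF.
Qed.

Lemma large_degree_suffices i : (0 < k)%N -> (33 * k ^ 2 <= #|T|)%N ->
  0 <= \sum_j x j -> ('C(#|T|.-1, k.-1) <= 4 * degree i)%N ->
  ('C(#|T|.-1, k.-1) <= #|nonneg_sets|)%N.
Proof.
move=> k0 nk x0 hdeg.
have [/existsP[B /and3P[/eqP cB iB Bneg]]|] :=
  boolP [exists B : {set T}, [&& #|B| == k, i \in B & \sum_(j in B) x j < 0]].
  have kT : (2 * k <= #|T|)%N by nia.
  have h := avoiding_ge k0 kT x0 cB iB Bneg.
  have e : (degree i + #|[set S in nonneg_sets | i \notin S]| = #|nonneg_sets|)%N.
    rewrite -(cardsID [set S : {set T} | i \in S] nonneg_sets) /degree.
    by congr (_ + _)%N; apply: eq_card => S; rewrite !inE // andbC.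
  (* Passing from [#|T| - 1] to [#|T| - 2 * k] removes [2 * k - 1] points; by [hk] this loses at
     most a quarter of the binomial coefficient, which [degree i] makes up for. *)
  have hb := bin_sub_ge #|T|.-1 (2 * k).-1 k.-1.
  have e2 : (#|T|.-1 - (2 * k).-1 = #|T| - 2 * k)%N by lia.
  rewrite e2 in hb.
  have hk : (4 * ((2 * k).-1 * k.-1) <= #|T|.-1)%N by nia.
  have n0 : (0 < #|T|.-1)%N by nia.
  rewrite -(leq_pmul2l n0); nia.
rewrite negb_exists => /forallP hB; apply: (star_le (i := i)) => // S cS iS.
by have := hB S; rewrite cS eqxx iS /= leNgt.
Qed.

(** * Bounding and summing the degrees *)

Lemma sum_gap_sq U (th l : R) : let D := \sum_(i in U) x i in
  0 <= D -> 0 <= th -> 2 * th <= 1 -> 16 * k%:R * th <= 1 -> 4 * k%:R <= l -> 0 < l ->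
  (forall j, j \in U -> - D <= l * x j) ->
  4 * k%:R * th * \sum_(i in U) x i ^+ 2 <=
  \sum_(i in U | 0 < x i) ((1 - th) * x i + th * D) ^+ 2.
Proof.
move=> D D0 th0 th2 thk lk l0 xD.
set S2 := \sum_(i in U | 0 < x i) x i ^+ 2.
set P := \sum_(i in U | 0 < x i) x i.
set Q := \sum_(i in U) x i ^+ 2.
have DE : D = P + \sum_(i in U | ~~ (0 < x i)) x i by rewrite /D (bigID (fun i => 0 < x i)).
clearbody D.
have P0 : 0 <= P by apply: sumr_ge0 => i /andP[_ /ltW].
have S20 : 0 <= S2 by apply: sumr_ge0 => i _; apply: sqr_ge0.
(* A nonpositive [x i] is at least [- D / l], so [l * x i ^+ 2 <= - D * x i]; these bounds add up to
   [D * P - D ^+ 2]. *)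
have hQ : l * Q <= l * S2 + D * P.
  rewrite /Q (bigID (fun i => 0 < x i)) /= mulrDr lerD2l.
  apply: (@le_trans _ _ (\sum_(i in U | ~~ (0 < x i)) - D * x i)).
    rewrite mulr_sumr; apply: ler_sum => i /andP[iU]; rewrite -leNgt => xi.
    by rewrite expr2 mulrA; apply: ler_wnM2r => //; apply: xD.
  rewrite -mulr_sumr.
  have -> : \sum_(i in U | ~~ (0 < x i)) x i = D - P.
    by apply/esym/eqP; rewrite subr_eq addrC DE.
  by have := sqr_ge0 D; lra.
have hg : (1 - th) ^+ 2 * S2 + 2 * th * (1 - th) * D * P <=
    \sum_(i in U | 0 < x i) ((1 - th) * x i + th * D) ^+ 2.
  rewrite /S2 /P !mulr_sumr -big_split /=; apply: ler_sum => i _.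
  rewrite -subr_ge0.
  by rewrite [leRHS](_ : _ = (th * D) ^+ 2); [exact: sqr_ge0 | ring].
apply: le_trans hg; rewrite -(ler_pM2l l0).
have k0 : 0 <= k%:R :> R by exact: ler0n.
have kth0 : 0 <= 4 * k%:R * th by rewrite !mulr_ge0.
apply: (@le_trans _ _ (4 * k%:R * th * (l * S2 + D * P))).
  by rewrite mulrCA ler_wpM2l.
have DP0 : 0 <= D * P by rewrite mulr_ge0.
have thDP0 : 0 <= th * (D * P) by rewrite mulr_ge0.
(* Here [4 * k * th <= 1 / 4 <= (1 - th) ^+ 2]. *)
have h1 : 4 * k%:R * th * (l * S2) <= l * ((1 - th) ^+ 2 * S2).
  rewrite mulrCA ler_pM2l // ler_wpM2r //; nra.
(* The cross term pays for the nonpositive values, as [4 * k <= l] and [1 <= 2 * (1 - th)]. *)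
have h2 : 4 * k%:R * th * (D * P) <= l * (2 * th * (1 - th) * D * P).
  rewrite [leRHS](_ : _ = (l * (2 * (1 - th))) * (th * (D * P))); last by ring.
  rewrite -[leLHS]mulrA ler_wpM2r //.
  apply: le_trans lk _; rewrite ler_peMr ?(ltW l0) //; lra.
lra.
Qed.

(** The other [k - 1] points are drawn from [U :\ i], whose sum is smaller by [x i]; hence the
    factor [1 - th]. Extending the sum of squares to all of [U] makes the variance bound the same
    for every [i]. *)
Lemma degree_cantelli U i :
  let th := k.-1%:R / #|U|.-1%:R : R in
  let g := (1 - th) * x i + th * \sum_(j in U) x j in
  (0 < k)%N -> (1 < #|U|)%N -> i \in U -> 0 < g ->
  'C(#|U|.-1, k.-1)%:R * g ^+ 2 <=
  (g ^+ 2 + th * \sum_(j in U) x j ^+ 2) * (degree i)%:R.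
Proof.
move=> th g k0 U1 iU g0.
have cU : #|U :\ i| = #|U|.-1 by rewrite (cardsD1 i U) iU.
have N0 : (0 < #|U :\ i|)%N by rewrite cU; lia.
have th0 : 0 <= th by rewrite divr_ge0.
have eg : x i + k.-1%:R / #|U :\ i|%:R * \sum_(j in U :\ i) x j = g.
  by rewrite cU -/th /g (big_setD1 i iU) /=; ring.
have := @cantelli _ _ (U :\ i) k.-1 x (x i) N0.
rewrite /= eg => /(_ g0); rewrite cU -/th => h; apply: le_trans h _.
have Q0 V : 0 <= g ^+ 2 + th * \sum_(j in V) x j ^+ 2.
  rewrite addr_ge0 ?sqr_ge0 // mulr_ge0 // sumr_ge0 // => j _; exact: sqr_ge0.
apply: ler_pM => //; last by rewrite ler_nat degree_ge.
rewrite lerD2l ler_wpM2l // [leRHS](big_setD1 i iU) /= lerDr; exact: sqr_ge0.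
Qed.

Lemma nonneg_sets_ge : (0 < k)%N -> (33 * k ^ 2 <= #|T|)%N ->
  0 <= \sum_j x j -> ('C(#|T|.-1, k.-1) <= #|nonneg_sets|)%N.
Proof.
move=> k0 nk x0; set C := 'C(_, _).
(* Without positive values, the sum condition forces every [x j] to be 0. *)
have [/existsP[i0 xi0]|] := boolP [exists i, 0 < x i]; last first.
  rewrite negb_exists => /forallP xle.
  have /card_gt0P[i _] : (0 < #|T|)%N by nia.
  have xN0 j : 0 <= - x j by rewrite oppr_ge0 leNgt xle.
  have /eqP : \sum_j - x j = 0.
    by apply/eqP; rewrite eq_le sumr_ge0 // sumrN oppr_le0 x0.
  rewrite psumr_eq0 // => /allP xj0.
  apply: (star_le (i := i)) => // S _ _; rewrite sumr_ge0 // => j _.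
  by have := xj0 j (mem_index_enum j); rewrite oppr_eq0 => /eqP->.
(* This [l] is small enough that removing [L] keeps at least half of the [(k-1)]-subsets ([l4]), yet
   at least [16 * k] because [32 * k ^ 2 <= #|T|]. *)
pose l := (#|T| %/ (2 * k))%N.
have ltn : (l * (2 * k) <= #|T|)%N by apply: leq_trunc_div.
have lk : (16 * k <= l)%N by rewrite leq_divRL; nia.
have [l1 [T1 l2] l3 l4] : [/\ (l <= #|T|)%N, (0 < #|T|.-1)%N /\ (1 < #|T| - l)%N,
    (16 * k * k.-1 <= (#|T| - l).-1)%N & (2 * (l * k.-1) <= #|T|.-1)%N].
  by clear -k0 nk ltn lk; clearbody l; do ?split; nia.
clearbody l.
have [L [_ cL hL]] : exists L : {set T}, [/\ L \subset setT, #|L| = l &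
    forall i j, i \in L -> j \in setT :\: L -> x i <= x j].
  by apply: smallest_subset; rewrite cardsT.
have LT := subsetT L.
pose U := setT :\: L.
have cU : #|U| = (#|T| - l)%N by rewrite cardsD cardsT (setIidPr LT) cL.
have xT : 0 <= \sum_(j in [set: T]) x j.
  by under eq_bigl => j do rewrite in_setT.
pose D := \sum_(j in U) x j.
have D0 : 0 <= D by apply: sum_rest_ge0.
(* The sum over [L] is at least [- D] and at most [l] times any value on [U]. *)
have xU j : j \in U -> - D <= l%:R * x j.
  move=> jU; have := sum_ge_smallest LT hL jU; rewrite cL.
  apply: le_trans; move: xT; rewrite (big_setID L) /= (setIidPr LT) -/U -/D; lra.
pose th : R := k.-1%:R / #|U|.-1%:R.
have [U1 Uk] : (1 < #|U|)%N /\ (16 * k * k.-1 <= #|U|.-1)%N by rewrite cU.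
have hC : (C <= 2 * 'C(#|U|.-1, k.-1))%N.
  by rewrite cU -subn1 subnAC subn1; apply: bin_sub_half l4.
have Up : 0 < #|U|.-1%:R :> R by rewrite ltr0n -subn1 subn_gt0.
have th0 : 0 <= th by rewrite divr_ge0.
have thU : th * #|U|.-1%:R = k.-1%:R by rewrite divfK // gt_eqF.
have k1 : 1 <= k%:R :> R by rewrite ler1n.
have thk : 16 * k%:R * th <= 1.
  rewrite -(ler_pM2r Up) mul1r (_ : _ * _ = 16 * k%:R * k.-1%:R); last by rewrite -thU; ring.
  by rewrite -!natrM ler_nat.
have th2 : 2 * th <= 1 by nra.
have [i iU xi] : exists2 i, i \in U & 0 < x i.
  have [i0U|i0U] := boolP (i0 \in U); first by exists i0.
  have i0L : i0 \in L by move: i0U; rewrite !inE andbT negbK.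
  have /card_gt0P[j jU] := ltnW U1.
  by exists j => //; apply: lt_le_trans xi0 (hL _ _ i0L jU).
pose g j := (1 - th) * x j + th * D.
have g0 j : 0 < x j -> 0 < g j.
  move=> xj; have := mulr_ge0 th0 D0.
  have : 0 < (1 - th) * x j by rewrite mulr_gt0 //; lra.
  rewrite /g; lra.
pose v := th * \sum_(j in U) x j ^+ 2.
have v0 : 0 <= v by rewrite mulr_ge0 // sumr_ge0 // => j _; apply: sqr_ge0.
have deg j : j \in U -> 0 < x j ->
    C%:R * g j ^+ 2 <= 2 * (g j ^+ 2 + v) * (degree j)%:R.
  move=> jU xj; have := degree_cantelli k0 U1 jU (g0 j xj).
  rewrite -/th -/D -/(g j) -/v => h; rewrite -mulrA.
  apply: (@le_trans _ _ ((2 * 'C(#|U|.-1, k.-1))%:R * g j ^+ 2)).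
    by rewrite ler_wpM2r ?sqr_ge0 // ler_nat.
  by rewrite natrM -mulrA ler_pM2l.
(* If [v <= g j ^+ 2], then [g j ^+ 2 + v <= 2 * g j ^+ 2], and [deg] gives degree at least
   [C / 4]. *)
have [/existsP[j /and3P[jU xj gv]]|] :=
  boolP [exists j, [&& j \in U, 0 < x j & v <= g j ^+ 2]].
  apply: (large_degree_suffices (i := j)) => //; rewrite -/C -(ler_nat R) natrM.
  have gj0 : 0 < g j ^+ 2 by rewrite exprn_gt0 // g0.
  have d0 : 0 <= (degree j)%:R :> R by [].
  rewrite -(ler_pM2r gj0); apply: le_trans (deg j jU xj) _; nra.
rewrite negb_exists => /forallP gv.
have {}gv j : j \in U -> 0 < x j -> g j ^+ 2 < v.
  by move=> jU xj; have := gv j; rewrite jU xj -ltNge.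
have vp : 0 < v by apply: le_lt_trans (gv i iU xi); apply: sqr_ge0.
(* Now [g j ^+ 2 + v <= 2 * v] at every positive [j] in [U]. *)
have hs : C%:R * \sum_(j in U | 0 < x j) g j ^+ 2 <= 4 * v * (k * #|nonneg_sets|)%:R.
  apply: (@le_trans _ _ (4 * v * \sum_(j in U | 0 < x j) (degree j)%:R)).
    rewrite !mulr_sumr; apply: ler_sum => j /andP[jU xj].
    apply: le_trans (deg j jU xj) _; rewrite ler_wpM2r //.
    have := gv j jU xj; lra.
  rewrite ler_wpM2l //; first by rewrite mulr_ge0.
  by rewrite -sum_degree natr_sum [leRHS](bigID (fun j => (j \in U) && (0 < x j))) /= lerDl sumr_ge0.
have lk4 : 4 * k%:R <= l%:R :> R by rewrite -natrM ler_nat (leq_trans _ lk) // leq_mul2r orbT.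
have lp : 0 < l%:R :> R by lra.
(* The sum in [hs] is at least [4 * k * v], which is positive and cancels. *)
have := sum_gap_sq D0 th0 th2 thk lk4 lp xU.
rewrite -/D -mulrA -/v => hg.
have vk : 0 < 4 * k%:R * v by rewrite mulr_gt0 // mulr_gt0 // ltr0n.
rewrite -(ler_nat R) -(ler_pM2r vk).
apply: (@le_trans _ _ (C%:R * \sum_(j in U | 0 < x j) g j ^+ 2)); first by rewrite ler_wpM2l.
by apply: le_trans hs _; rewrite natrM; lra.
Qed.

End NonnegativeSums.

Theorem theorem3p5 (R : realType) (n k : nat) (n_gt0 : (0 < n)%N)
  (k_gt0 : (0 < k)%N) (n_ge : (33 * k ^ 2 <= n)%N) (x : 'I_n -> R)
  (x_ge0 : 0 <= \sum_(i < n) x i) :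
  ('C(n.-1, k.-1) <=
     #|[set S : {set 'I_n} | (#|S| == k) && (0 <= \sum_(i in S) x i)%R]|)%N.
Proof.
have := @nonneg_sets_ge R 'I_n k x; rewrite card_ord => h.
exact: h k_gt0 n_ge x_ge0.
Qed.
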